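(* Let $n\geq 3$ and $1\leq k<n$ be integers and $X=(k,n)=\{k+1,\dots,n-1\}$. Then the Pak–Stanley labeling $\ell$ of the regions of $\mathcal{A}^{X}$ is a bijection from the set of regions of $\mathcal{A}^{X}$ onto the set of $\mathcal{G}^{X}$-parking functions.
   Context: For $1\leq i<j\leq n$ define hyperplanes of $\mathbb{R}^n$: $C_{ij}=\{x: x_i=x_j\}$, $S_{ij}=\{x: x_i=x_j+1\}$, $I_{ij}=\{x: x_1=x_j+i\}$. For $X\subseteq\{2,\dots,n-1\}$ let $\mathcal{A}^X=\{C_{ij}:1\leq i<j\leq n\}\cup\{S_{ij}: i\in X,\ i<j\leq n\}\cup\{I_{ij}: i\in[n]\setminus X,\ i<j\leq n\}$. Regions are the connected components of the complement in $\mathbb{R}^n$ of the union of the hyperplanes. Pak–Stanley labeling: let $\mathcal{R}_0$ be the region $\{x: x_n+1>x_1>x_2>\dots>x_n\}$ and set $\ell(\mathcal{R}_0)=(0,\dots,0)$; whenever two regions $\mathcal{R}_1,\mathcal{R}_2$ are separated by a hyperplane $H$ of the arrangement (adjacent across $H$) with $\mathcal{R}_0$ and $\mathcal{R}_1$ on the same side of $H$, set $\ell(\mathcal{R}_2)=\ell(\mathcal{R}_1)+\mathbf{e}_i$ if $H=C_{ij}$ and $\ell(\mathcal{R}_2)=\ell(\mathcal{R}_1)+\mathbf{e}_j$ if $H=S_{ij}$ or $H=I_{ij}$, where $\mathbf{e}_i$ is the $i$-th standard unit vector of $\mathbb{Z}^n$. This yields a well-defined map from regions to $\mathbb{N}_0^n$,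 viewed as functions $[n]\to\mathbb{N}_0$. The directed multigraph $\mathcal{G}^X$ has vertex set $[n]$ and one arc for each hyperplane of $\mathcal{A}^X$: arc $(i,j)$ for $C_{ij}$, arc $(j,i)$ for $S_{ij}$, arc $(j,1)$ for $I_{ij}$ (so arcs $(j,1)$ may have multiplicity). For a directed multigraph $\mathcal{G}=(V,A)$ on $[n]$, a function $\mathbf{a}\colon[n]\to\mathbb{N}_0$ is a $\mathcal{G}$-parking function if for every nonempty $I\subseteq[n]$ there is $i\in I$ such that the number of arcs $(i,j)\in A$ with $j\notin I$, counted with multiplicity, is at least $\mathbf{a}(i)$. *)

(* Defs.v *)
From HB Require Import structures.
From mathcomp Require Import all_boot all_order all_algebra.
From mathcomp Require Import all_classical all_reals all_analysis.

Set Implicit Arguments.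
Unset Strict Implicit.
Unset Printing Implicit Defensive.

Import Order.TTheory GRing.Theory Num.Theory.
Import numFieldNormedType.Exports.

Local Open Scope classical_set_scope.
Local Open Scope ring_scope.

(* The index set [n] = {1, ..., n} is 'I_n, the ordinal i standing for the
   integer i.+1. A point of R^n is a row vector x, with coordinates x 0 i. *)

(* Names of the hyperplanes C_ij, S_ij, I_ij. Those that occur in an
   arrangement A^X, where 1 is not in X, are pairwise distinct as sets, so a
   hyperplane of A^X may be identified with its name. *)
Inductive hyp (n : nat) : Type :=
  | HC of 'I_n & 'I_n
  | HS of 'I_n & 'I_n
  | HI of 'I_n & 'I_n.

Definition hyp_code n (h : hyp n) :
    ('I_n * 'I_n) + (('I_n * 'I_n) + ('I_n * 'I_n)) :=
  match h with
  | HC i j => inl (i, j)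
  | HS i j => inr (inl (i, j))
  | HI i j => inr (inr (i, j))
  end.

Definition hyp_decode n
    (c : ('I_n * 'I_n) + (('I_n * 'I_n) + ('I_n * 'I_n))) : hyp n :=
  match c with
  | inl p => HC p.1 p.2
  | inr (inl p) => HS p.1 p.2
  | inr (inr p) => HI p.1 p.2
  end.

Lemma hyp_codeK n : cancel (@hyp_code n) (@hyp_decode n).
Proof. by case. Qed.

HB.instance Definition _ n := Finite.copy (hyp n) (can_type (@hyp_codeK n)).

(* The element 1 of [n], which is nonempty since it contains i. *)
Definition ord_first n (i : 'I_n) : 'I_n :=
  Ordinal (leq_ltn_trans (leq0n i) (ltn_ord i)).

(* Every hyperplane has the form x_a = x_b + c, where a, b, c are given by
   hyp_lhs, hyp_rhs and hyp_cst:
     C_ij : x_i = x_j,  S_ij : x_i = x_j + 1,  I_ij : x_1 = x_j + i. *)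
Definition hyp_lhs n (h : hyp n) : 'I_n :=
  match h with HC i _ => i | HS i _ => i | HI i _ => ord_first i end.

Definition hyp_rhs n (h : hyp n) : 'I_n :=
  match h with HC _ j => j | HS _ j => j | HI _ j => j end.

Definition hyp_cst n (h : hyp n) : nat :=
  match h with HC _ _ => 0%N | HS _ _ => 1%N | HI i _ => i.+1 end.

Definition hyperplane (R : realType) n (h : hyp n) : set 'rV[R]_n :=
  [set x | x 0 (hyp_lhs h) = x 0 (hyp_rhs h) + (hyp_cst h)%:R].

Definition hyp_above (R : realType) n (h : hyp n) : set 'rV[R]_n :=
  [set x | x 0 (hyp_lhs h) > x 0 (hyp_rhs h) + (hyp_cst h)%:R].

Definition hyp_below (R : realType) n (h : hyp n) : set 'rV[R]_n :=
  [set x | x 0 (hyp_lhs h) < x 0 (hyp_rhs h) + (hyp_cst h)%:R].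

Arguments hyperplane R {n} h.
Arguments hyp_above R {n} h.
Arguments hyp_below R {n} h.

Definition arrangement n (X : {set 'I_n}) : {set hyp n} :=
  finset (fun h : hyp n =>
    match h with
    | HC i j => (i < j)%N
    | HS i j => (i \in X) && (i < j)%N
    | HI i j => (i \notin X) && (i < j)%N
    end).

Definition arr_complement (R : realType) n (X : {set 'I_n}) : set 'rV[R]_n :=
  ~` \bigcup_(h in [set` arrangement X]) hyperplane R h.

Arguments arr_complement R {n} X.

Definition regions (R : realType) n (X : {set 'I_n}) : set (set 'rV[R]_n) :=
  [set connected_component (arr_complement R X) x | x in arr_complement R X].

Arguments regions R {n} X.

Definition base_region (R : realType) n : set 'rV[R]_n :=
  [set x | (forall i j : 'I_n, (i < j)%N -> x 0 i > x 0 j) /\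
           (forall i j : 'I_n, i = 0%N :> nat -> j.+1 = n ->
              x 0 j + 1 > x 0 i)].

Arguments base_region R n : clear implicits.

Definition same_side (R : realType) n (h : hyp n) (U V : set 'rV[R]_n) : Prop :=
  (U `<=` hyp_above R h /\ V `<=` hyp_above R h) \/
  (U `<=` hyp_below R h /\ V `<=` hyp_below R h).

Definition separates (R : realType) n (h : hyp n) (U V : set 'rV[R]_n) : Prop :=
  (U `<=` hyp_above R h /\ V `<=` hyp_below R h) \/
  (U `<=` hyp_below R h /\ V `<=` hyp_above R h).

(* Two regions are adjacent across h when h is the unique hyperplane of the
   arrangement that separates them. *)
Definition adjacent_across (R : realType) n (X : {set 'I_n}) (h : hyp n)
    (U V : set 'rV[R]_n) : Prop :=
  [/\ h \in arrangement X, separates h U V &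
      forall h', h' \in arrangement X -> separates h' U V -> h' = h].

(* The coordinate of the label incremented when crossing h. *)
Definition hyp_label n (h : hyp n) : 'I_n :=
  match h with HC i _ => i | HS _ j => j | HI _ j => j end.

(* The values of l outside regions R X are irrelevant. *)
Definition pak_stanley_labeling (R : realType) n (X : {set 'I_n})
    (l : set 'rV[R]_n -> {ffun 'I_n -> nat}) : Prop :=
  l (base_region R n) = [ffun=> 0%N] /\
  forall (R1 R2 : set 'rV[R]_n) (h : hyp n),
    regions R X R1 -> regions R X R2 ->
    adjacent_across X h R1 R2 -> same_side h (base_region R n) R1 ->
    l R2 = [ffun m => (l R1 m + (m == hyp_label h))%N].

(* A directed multigraph on [n] is given by the list of its arcs, with
   repetitions. *)
Definition hyp_arc n (h : hyp n) : 'I_n * 'I_n :=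
  match h with
  | HC i j => (i, j)
  | HS i j => (j, i)
  | HI i j => (j, ord_first i)
  end.

Definition digraph n (X : {set 'I_n}) : seq ('I_n * 'I_n) :=
  [seq hyp_arc h | h <- enum (arrangement X)].

Definition parking_functions n (A : seq ('I_n * 'I_n)) :
    set {ffun 'I_n -> nat} :=
  [set a | forall I : {set 'I_n}, I != finset.set0 ->
     exists2 i : 'I_n, i \in I &
       (a i <= count (fun e : 'I_n * 'I_n => (e.1 == i) && (e.2 \notin I)) A)%N].

(* The set (k, n) = {k+1, ..., n-1}. *)
Definition open_interval n (k : nat) : {set 'I_n} :=
  finset (fun i : 'I_n => (k < i.+1 < n)%N).

Arguments open_interval n k : clear implicits.

(* Main.v *)
Require Import Defs.
From HB Require Import structures.
From mathcomp Require Import all_boot all_order all_algebra.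
From mathcomp Require Import all_classical all_reals all_analysis.
From mathcomp Require Import zify ring lra.

Set Implicit Arguments.
Unset Strict Implicit.
Unset Printing Implicit Defensive.

Import Order.TTheory GRing.Theory Num.Theory.
Import numFieldNormedType.Exports.

Local Open Scope ring_scope.

(** A hyperplane h of the arrangement is an arc s -> t of weight c, and it
    separates x from the base region exactly when x_s + c < x_t; so the label of
    the region of x at s counts the arcs leaving s that x crosses in this sense.
    Looking at a vertex of I where x is maximal shows that labels are parking
    functions.

    Conversely a parking function a is burned from +oo downwards. When time
    reaches t, an arc s -> j of weight c with g_j - c >= t has been seen by s.
    If some unplaced vertex has seen exactly a of its arcs, the smallest such
    vertex is placed just below t; otherwise t drops to the next value g_j - c.
    The parking condition says that this never gets stuck, and the resulting g
    has label a. Every x with label a agrees with g at each stage, by two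
    features of these particular arcs: an arc s -> t of weight c > 0 yields an
    arc s' -> t of weight c for every s' > s, and the relative order of two
    values g_j - c, g_j' - c' is itself decided by an arc between j and j'.
    Hence a determines the region.

    A labeling is determined by its recursion because a generic segment to the
    base region crosses the hyperplanes one at a time. *)

(** * Hyperplanes as weighted arcs *)

Definition hyp_tgt n (h : hyp n) : 'I_n := (hyp_arc h).2.

Lemma hyp_arcE n (h : hyp n) : hyp_arc h = (hyp_label h, hyp_tgt h).
Proof. by case: h. Qed.

Lemma hyp_cst_le n (h : hyp n) : (hyp_cst h <= n)%N.
Proof. by case: h => //= i j; apply: leq_trans (ltn_ord j); case: i. Qed.

(** The disjuncts are the C-, S- and I-hyperplanes, with vertices numbered from 0: S-arcs have
    targets at least [k], and I-arcs all end at vertex 0, with weights from 1 to [k]. *)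
Definition is_arc (k s t c : nat) : bool :=
  [|| (c == 0) && (s < t), (c == 1) && (k <= t < s)
    | [&& t == 0, 0 < c <= k & c <= s]]%N.

Section Arcs.
Variables (n k : nat).
Local Notation arr := (arrangement (open_interval n k)).

Lemma arrangement_arc (h : hyp n) :
  h \in arr -> is_arc k (hyp_label h) (hyp_tgt h) (hyp_cst h).
Proof.
rewrite /is_arc /hyp_tgt; case: h => i j; rewrite !inE /=.
- lia.
- have := ltn_ord j; lia.
- have := ltn_ord j; lia.
Qed.

Lemma arc_arrangement (s t : 'I_n) (c : nat) : is_arc k s t c ->
  exists2 h, h \in arr & [/\ hyp_label h = s, hyp_tgt h = t & hyp_cst h = c].
Proof.
rewrite /is_arc => /or3P[/andP[/eqP -> st]|/andP[/eqP -> st]|/and3P[/eqP t0 ck cs]].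
- by exists (HC s t); rewrite ?inE.
- exists (HS t s); rewrite ?inE //; have := ltn_ord s; lia.
- have cn : (c.-1 < n)%N by have := ltn_ord s; lia.
  exists (HI (Ordinal cn) s); rewrite ?inE /=.
    have := ltn_ord s; lia.
  by split=> //; [apply: val_inj | lia].
Qed.

(** Positivity of [k] keeps the targets of S-arcs away from vertex 0, so an S-arc is never confused
    with an I-arc of weight 1. *)
Lemma arrangement_inj (h h' : hyp n) : (0 < k)%N -> h \in arr -> h' \in arr ->
  hyp_label h = hyp_label h' -> hyp_tgt h = hyp_tgt h' ->
  hyp_cst h = hyp_cst h' -> h = h'.
Proof.
move=> k_gt0.
case: h => i j; case: h' => i' j'; rewrite !inE /hyp_tgt /= => hA hA' //.
- by move=> -> ->.
- by move=> -> ->.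
- by move=> _ /(congr1 val) /= i0 _; move: hA; rewrite i0; lia.
- by move=> _ /(congr1 val) /= i0 _; move: hA'; rewrite -i0; lia.
- by move=> -> _ [] /val_inj ->.
Qed.

End Arcs.

(** * Labels of points and the parking property *)

Section Labels.
Variables (R : realType) (n : nat) (arr : {set hyp n}).
Implicit Types (f g x : 'I_n -> R) (h : hyp n).

Definition crossed f h : bool :=
  f (hyp_label h) + (hyp_cst h)%:R < f (hyp_tgt h).

Definition off_arrangement f : Prop := forall h, h \in arr ->
  f (hyp_label h) + (hyp_cst h)%:R != f (hyp_tgt h).

Definition pslabel f (m : 'I_n) : nat :=
  #|[pred h in arr | (hyp_label h == m) && crossed f h]|.

Lemma parking_functionsP (a : {ffun 'I_n -> nat}) :
  parking_functions [seq hyp_arc h | h <- enum arr] a <->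
  forall I : {set 'I_n}, I != finset.set0 -> exists2 i, i \in I &
    (a i <= #|[pred h in arr | (hyp_label h == i) && (hyp_tgt h \notin I)]|)%N.
Proof.
have cE I i : count (fun e : 'I_n * 'I_n => (e.1 == i) && (e.2 \notin I))
    [seq hyp_arc h | h <- enum arr]
    = #|[pred h in arr | (hyp_label h == i) && (hyp_tgt h \notin I)]|.
  rewrite count_map -sum1_count -sum1_card big_enum_cond /=.
  by apply: eq_bigl => h; rewrite !inE hyp_arcE.
by split=> + I I0 => /(_ I I0)[i iI ai]; exists i => //; move: ai; rewrite cE.
Qed.

(** A crossed arc strictly raises [f], so those leaving a maximum of [f] on [I] end outside [I]. *)
Lemma pslabel_parking f :
  parking_functions [seq hyp_arc h | h <- enum arr] [ffun m => pslabel f m].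
Proof.
apply/parking_functionsP => I /set0Pn[i0 i0I].
case: (arg_maxP f i0I) => i iI imax.
exists i => //; rewrite ffunE; apply: subset_leq_card.
apply/fintype.subsetP => h; rewrite !inE => /and3P[-> /eqP hi].
rewrite hi eqxx /= /crossed hi => c.
apply/negP => /imax /=; apply/negP; rewrite -ltNge.
by apply: le_lt_trans c; rewrite lerDl ler0n.
Qed.

Lemma eq_pslabel f g : (forall h, h \in arr -> crossed f h = crossed g h) ->
  pslabel f =1 pslabel g.
Proof.
move=> fg m; apply: eq_card => h; rewrite !inE.
by case: (boolP (h \in arr)) => //= /fg ->.
Qed.

End Labels.

(** Serves to place a vertex just below [t], and later to stop just past the first crossing on a
    segment, with no listed value in between. *)
Lemma exists_lt_above (R : realFieldType) (s : seq R) (t : R) :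
  exists2 t', t' < t & {in s, forall v, v < t -> v < t'}.
Proof.
elim: s => [|v s [t' t't IH]]; first by exists (t - 1) => //; lra.
case: (ltP v t) => vt; last first.
  by exists t' => // w; rewrite inE => /orP[/eqP ->|/IH //]; lra.
have lt : Num.max v t' < t by rewrite gt_max vt.
exists ((Num.max v t' + t) / 2); first lra.
have := le_max v v t'; have := le_max t' v t'; rewrite !lexx orbT /= => h1 h2.
move=> w; rewrite inE => /orP[/eqP -> _|/IH h /h]; lra.
Qed.

(** * Burning: reconstructing a point from a parking function *)

Section Greedy.
Variables (R : realType) (n k : nat).
Variable arr : {set hyp n}.
Hypothesis arr_arc : forall h, h \in arr ->
  is_arc k (hyp_label h) (hyp_tgt h) (hyp_cst h).
Hypothesis arc_arr : forall (s t : 'I_n) c, is_arc k s t c ->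
  exists2 h, h \in arr & [/\ hyp_label h = s, hyp_tgt h = t & hyp_cst h = c].
Hypothesis arr_inj : forall h h', h \in arr -> h' \in arr ->
  hyp_label h = hyp_label h' -> hyp_tgt h = hyp_tgt h' ->
  hyp_cst h = hyp_cst h' -> h = h'.
Variable a : {ffun 'I_n -> nat}.
Hypothesis a_parking : parking_functions [seq hyp_arc h | h <- enum arr] a.
Implicit Types (P : {set 'I_n}) (g x : 'I_n -> R) (t : R) (h : hyp n).

Definition seen P g t h : bool :=
  (hyp_tgt h \in P) && (t + (hyp_cst h)%:R <= g (hyp_tgt h)).

Definition seen_from P g t (i : 'I_n) : nat :=
  #|[pred h in arr | (hyp_label h == i) && seen P g t h]|.

Definition labelled_by_a x : Prop :=
  off_arrangement arr x /\
  pslabel arr x =1 a.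

(* Vertices outside P still have to be placed, below t; the values of g there
   are junk. *)
Record greedy_state P g t : Prop := GreedyState {
  gs_above : forall i, i \in P -> t <= g i;
  gs_generic : forall i j c, i \in P -> j \in P -> i != j -> (c <= n)%N ->
    g i + c%:R != g j;
  gs_placed : forall i, i \in P ->
    #|[pred h in arr | (hyp_label h == i) &&
       ((hyp_tgt h \in P) && crossed g h)]| = a i;
  gs_unplaced : forall i, i \notin P -> (seen_from P g t i <= a i)%N;
  gs_agree : forall x, labelled_by_a x ->
    forall h, h \in arr -> hyp_label h \in P ->
    crossed x h = (hyp_tgt h \in P) && crossed g h;
  gs_agree_seen : forall x, labelled_by_a x ->
    forall h, h \in arr -> hyp_label h \notin P -> seen P g t h -> crossed x h
}.

Lemma arr_label_tgt h : h \in arr -> hyp_label h != hyp_tgt h.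
Proof.
by move=> /arr_arc; rewrite /is_arc -val_eqE /=; lia.
Qed.

Lemma arr_HC (i j : 'I_n) : (i < j)%N ->
  exists2 h, h \in arr & [/\ hyp_label h = i, hyp_tgt h = j & hyp_cst h = 0%N].
Proof. by move=> ij; apply: arc_arr; rewrite /is_arc ij. Qed.

Lemma off_arr_inj x (i j : 'I_n) : off_arrangement arr x -> i != j -> x i != x j.
Proof.
move=> xo; rewrite -val_eqE neq_ltn => /orP[] /arr_HC[h hA [hi hj hc]].
  by have := xo h hA; rewrite hi hj hc addr0.
by have := xo h hA; rewrite hi hj hc addr0 eq_sym.
Qed.

(** The seen arcs at [i] are among those crossed by [x], and both sets have [a i] elements, so they
    coincide. *)
Lemma gs_ready P g t i x : greedy_state P g t -> i \notin P ->
  seen_from P g t i = a i -> labelled_by_a x ->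
  forall h, h \in arr -> hyp_label h = i -> crossed x h = seen P g t h.
Proof.
move=> gs iP ri xa h hA hi.
have sub : [pred h in arr | (hyp_label h == i) && seen P g t h] \subset
    [pred h in arr | (hyp_label h == i) && crossed x h].
  apply/fintype.subsetP => h'; rewrite !inE => /and3P[h'A /eqP h'i sh'].
  by rewrite h'A h'i eqxx /= (gs_agree_seen gs xa) // h'i.
have : #|[pred h in arr | (hyp_label h == i) && seen P g t h]| =
    #|[pred h in arr | (hyp_label h == i) && crossed x h]|.
  by rewrite -[LHS]/(seen_from P g t i) ri; case: xa => _ <-.
by move=> /subset_cardP /(_ sub) /(_ h); rewrite !inE hA hi eqxx.
Qed.

(** By counting, [x] crosses an unseen arc at [m]. Its target is placed because [x] is maximal at
    [m] among unplaced vertices, and its weight is positive because weight-0 arcs into [P] are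
    always seen. *)
Lemma gs_top P g t m x : greedy_state P g t -> m \notin P ->
  (seen_from P g t m < a m)%N -> labelled_by_a x ->
  (forall j, j \notin P -> x j <= x m) ->
  exists h, [/\ h \in arr, hyp_label h = m, crossed x h, hyp_tgt h \in P &
    (g (hyp_tgt h) < t + (hyp_cst h)%:R) && (0 < hyp_cst h)%N].
Proof.
move=> gs mP lm xa xm.
have : ~~ ([pred h in arr | (hyp_label h == m) && crossed x h] \subset
    [pred h in arr | (hyp_label h == m) && seen P g t h]).
  apply: contraTN lm => /subset_leq_card; rewrite -leqNgt.
  by case: xa => _ <-.
case/subsetPn => h; rewrite !inE => /and3P[hA /eqP hm ch].
rewrite hA hm eqxx /= => nsh; exists h.
have tP : hyp_tgt h \in P.
  apply: contraT => /xm; rewrite leNgt => /negP[].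
  by move: ch; rewrite /crossed hm; apply: le_lt_trans; rewrite lerDl ler0n.
move: nsh; rewrite /seen tP /= -ltNge => lt; split=> //.
rewrite lt lt0n; apply/eqP => c0; move: lt.
by rewrite c0 addr0 ltNge (gs_above gs).
Qed.

(** The crux is [itop]: every [x] with label [a] has its strict maximum over unplaced vertices at
    [i], hence crosses the weight-0 arcs into [i] that become seen. *)
Lemma gs_place P g t i : greedy_state P g t -> i \notin P ->
  seen_from P g t i = a i ->
  (forall j, j \notin P -> (j < i)%N -> (seen_from P g t j < a j)%N) ->
  exists g' t', greedy_state (i |: P) g' t'.
Proof.
move=> gs iP ri mini.
(* No value [g j - c] with [c <= n] lies in the gap from [t'] up to [t], so both times compare alike
   with all of them. *)
have [t' t't Ht'] := exists_lt_above
  [seq g j - c%:R | j <- enum 'I_n, c <- iota 0 n.+1] t.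
have {}Ht' j c : (c <= n)%N -> (g j < t + c%:R) = (g j < t' + c%:R).
  move=> cn; apply/idP/idP => [lt|]; last lra.
  have := Ht' (g j - c%:R); rewrite ltrBlDr lt; move=> /(_ _ isT).
  rewrite ltrBlDr; apply.
  by apply/allpairsP; exists (j, c); rewrite mem_enum mem_iota.
pose g' j := if j == i then t' else g j.
have g'i : g' i = t' by rewrite /g' eqxx.
have g'P j : j \in P -> g' j = g j.
  by rewrite /g'; case: eqP => // -> ; rewrite (negPf iP).
have crP h : hyp_label h \in P ->
    (hyp_tgt h \in i |: P) && crossed g' h = (hyp_tgt h \in P) && crossed g h.
  move=> lP; rewrite finset.in_setU1 /crossed (g'P _ lP).
  have [->|ti] := eqVneq (hyp_tgt h) i.
    rewrite (negPf iP) /= g'i; apply/negbTE; rewrite -leNgt.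
    have := gs_above gs lP; have := ler0n R (hyp_cst h); lra.
  by case: (boolP (_ \in P)) => //= tP; rewrite g'P.
have cri h : h \in arr -> hyp_label h = i ->
    (hyp_tgt h \in i |: P) && crossed g' h = seen P g t h.
  move=> hA hi; have := arr_label_tgt hA; rewrite hi => it.
  rewrite finset.in_setU1 eq_sym (negPf it) /= /crossed /seen hi g'i.
  case: (boolP (_ \in P)) => //= tP; rewrite g'P //.
  have := Ht' (hyp_tgt h) _ (hyp_cst_le h).
  move=> H; apply/idP/idP => [lt|]; last lra.
  by rewrite leNgt H -leNgt ltW.
have seenE h : seen (i |: P) g' t' h =
    if hyp_tgt h == i then hyp_cst h == 0%N else seen P g t h.
  rewrite /seen finset.in_setU1; have [->|ti] /= := eqVneq (hyp_tgt h) i.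
    by rewrite g'i gerDl lern0.
  case: (boolP (_ \in P)) => //= tP; rewrite g'P // !leNgt.
  by rewrite (Ht' _ _ (hyp_cst_le h)).
have itop x : labelled_by_a x -> forall m, m \notin P -> m != i -> x m < x i.
  move=> xa m mP mi.
  have [m0 m0P m0max] := arg_maxP x (iP : (fun j => j \notin P) i).
  suff m0i : m0 = i.
    rewrite lt_neqAle (off_arr_inj (proj1 xa) mi) /=.
    by rewrite -m0i; exact: m0max.
  (* If [m0 < i], then [m0] is not ready and crosses an unseen arc of positive weight. The larger
     vertex [i] has a parallel arc, also unseen, hence uncrossed, although [x i <= x m0]. *)
  apply: val_inj; have [m0i|im0|//] := ltngtP m0 i; exfalso.
    have [h [hA hm ch tP /andP[lt c0]]] :=
      gs_top gs m0P (mini _ m0P m0i) xa m0max.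
    have [h' h'A [h'i h't h'c]] : exists2 h', h' \in arr & [/\ hyp_label h' = i,
        hyp_tgt h' = hyp_tgt h & hyp_cst h' = hyp_cst h].
      by apply: arc_arr; move: (arr_arc hA); rewrite hm /is_arc; lia.
    have := gs_ready gs iP ri xa h'A h'i.
    rewrite /seen /crossed h't tP h'i h'c /= [RHS]leNgt lt /=.
    move: ch; rewrite /crossed hm => ch /negbT; rewrite -leNgt.
    by have := m0max _ iP; rewrite /=; lra.
  (* If [i < m0], the weight-0 arc from [i] to the unplaced [m0] is unseen, hence uncrossed, which
     forces [x m0 <= x i]. *)
  have [h' h'A [h'i h't h'c]] := arr_HC im0.
  have := gs_ready gs iP ri xa h'A h'i.
  rewrite /seen /crossed h't (negPf m0P) /= h'i h'c addr0 => /negbT.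
  rewrite -leNgt => le; have := m0max _ iP => /= le'.
  have /negP[] := off_arr_inj (proj1 xa) (negbT (gtn_eqF im0)).
  by apply/eqP/le_anti; rewrite le le'.
exists g', t'; split.
- move=> j; rewrite finset.in_setU1 => /orP[/eqP ->|jP]; first by rewrite g'i.
  by rewrite g'P //; apply: le_trans (gs_above gs jP); exact: ltW.
- move=> j l c; rewrite !finset.in_setU1.
  move=> /orP[/eqP ->|jP] /orP[/eqP ->|lP] jl cn; first by rewrite eqxx in jl.
  + rewrite g'i g'P //; apply/eqP => e.
    by have := Ht' l c cn; rewrite -e ltxx ltrD2r t't.
  + rewrite g'i g'P //; apply/eqP => e.
    by have := gs_above gs jP; have := ler0n R c; lra.
  + by rewrite !g'P //; exact: (gs_generic gs).
- move=> j; rewrite finset.in_setU1 => /orP[/eqP ->|jP].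
    rewrite -ri; apply: eq_card => h; rewrite !inE.
    case: (boolP (h \in arr)) => //= hA; case: eqP => //= hi.
    by rewrite -finset.in_setU1 cri.
  rewrite -(gs_placed gs jP); apply: eq_card => h; rewrite !inE.
  case: (boolP (h \in arr)) => //= hA; case: eqP => //= hj.
  by rewrite -finset.in_setU1 crP ?hj.
- move=> j; rewrite finset.in_setU1 negb_or => /andP[ji jP].
  (* A smaller [j] gains only its weight-0 arc to [i] and has room for it by [mini]; a larger one
     has no weight-0 arc to [i]. *)
  have [ltji|leij] := ltnP j i.
    have [h0 h0A [h0j h0i h0c]] := arr_HC ltji.
    apply: leq_trans (mini _ jP ltji); rewrite /seen_from.
    apply: (@leq_trans #|[predU1 h0 &
      [pred h in arr | (hyp_label h == j) && seen P g t h]]|); last first.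
      by rewrite cardU1 -add1n leq_add2r; case: (_ \notin _).
    apply: subset_leq_card; apply/fintype.subsetP => h.
    rewrite !inE => /and3P[hA /eqP hj]; rewrite seenE hA hj eqxx /=.
    case: eqP => [hi /eqP hc|_ ->]; last by rewrite orbT.
    by rewrite (arr_inj hA h0A) ?eqxx // ?hj ?hi ?hc.
  apply: leq_trans (gs_unplaced gs jP); apply: subset_leq_card.
  apply/fintype.subsetP => h; rewrite !inE => /and3P[hA /eqP hj].
  rewrite seenE hA hj eqxx; case: eqP => // hi /eqP hc.
  by move: (arr_arc hA); rewrite hj hi hc /is_arc; move: ji; rewrite -val_eqE /=; lia.
- move=> x xa h hA; rewrite finset.in_setU1 => /orP[/eqP hi|hP].
    by rewrite cri // (gs_ready gs _ ri).
  by rewrite crP // (gs_agree gs).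
- move=> x xa h hA; rewrite finset.in_setU1 negb_or => /andP[ji jP].
  rewrite seenE; case: eqP => [hi /eqP hc|_ sh]; last exact: (gs_agree_seen gs).
  by rewrite /crossed hi hc addr0 itop.
Qed.

Lemma gs_arc P g t x (p q : 'I_n) c : greedy_state P g t -> labelled_by_a x ->
  p \in P -> q \in P -> is_arc k p q c ->
  (x p + c%:R < x q) = (g p + c%:R < g q).
Proof.
move=> gs xa pP qP /arc_arr[h hA [hp hq hc]].
by have := gs_agree gs xa hA; rewrite hp /crossed hp hq hc qP; apply.
Qed.

Lemma gs_order P g t x (p q : 'I_n) : greedy_state P g t -> labelled_by_a x ->
  p \in P -> q \in P -> g p < g q -> x p <= x q.
Proof.
move=> gs xa pP qP gpq; have [pq|qp|/val_inj pq] := ltngtP p q.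
- have := gs_arc gs xa pP qP (c := 0); rewrite /is_arc pq => /(_ isT).
  by rewrite !addr0 gpq => /ltW.
- have := gs_arc gs xa qP pP (c := 0); rewrite /is_arc qp => /(_ isT).
  by rewrite !addr0 (ltNge (g q)) (ltW gpq) => /negbT; rewrite -leNgt.
- by rewrite pq.
Qed.

(* The order in which delayed events occur is itself recorded by arcs between
   their targets. *)
Lemma gs_fifo P g t x h1 h2 : greedy_state P g t -> labelled_by_a x ->
  h1 \in arr -> h2 \in arr -> (0 < hyp_cst h1)%N -> (0 < hyp_cst h2)%N ->
  hyp_tgt h1 \in P -> hyp_tgt h2 \in P ->
  g (hyp_tgt h2) + (hyp_cst h1)%:R < g (hyp_tgt h1) + (hyp_cst h2)%:R ->
  x (hyp_tgt h2) + (hyp_cst h1)%:R <= x (hyp_tgt h1) + (hyp_cst h2)%:R.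
Proof.
move=> gs xa /arr_arc + /arr_arc + + + t1P t2P.
move: (hyp_tgt h1) (hyp_tgt h2) (hyp_cst h1) (hyp_cst h2)
  t1P t2P => t1 t2 [//|c1] [//|c2] t1P t2P.
move: (hyp_label h1) (hyp_label h2) => l1 l2 a1 a2 _ _.
(* Lowering both weights by one preserves the comparison and brings it to a form decided by an arc
   between [t1] and [t2]. *)
rewrite -!natr1 => lt.
have lt' : g t2 + c1%:R < g t1 + c2%:R by lra.
suff : x t2 + c1%:R <= x t1 + c2%:R by lra.
have [c20|c20] := posnP c2; last first.
  have [c10|c10] := posnP c1; last first.
    have t1t2 : t1 = t2 by apply: val_inj; move: a1 a2; rewrite /is_arc /=; lia.
    by move: lt'; rewrite t1t2 ltrD2l lerD2l => /ltW.
  have [t1t2|t1t2] := eqVneq t1 t2.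
    by rewrite t1t2 c10 addr0 lerDl ler0n.
  (* The second arc has weight at least 2, so it is an I-arc and [t2] is 0. As [t1] differs from 0,
     it is the target of an S-arc, hence at least [k], which exceeds [c2]; so [t1] is the source of
     an I-arc of weight [c2]. *)
  have arc : is_arc k t1 t2 c2.
    by move: a1 a2 t1t2; rewrite /is_arc -val_eqE /=; lia.
  have := gs_arc gs xa t1P t2P arc; rewrite c10 in lt' *.
  rewrite (ltNge _ (g t2)); have -> /= : g t2 <= g t1 + c2%:R by lra.
  by move/negbT; rewrite -leNgt; lra.
have [c10|c10] := posnP c1.
  rewrite c10 c20 !addr0 in lt' *; exact: (gs_order gs xa).
have [t1t2|t1t2] := eqVneq t1 t2.
  by move: lt'; rewrite t1t2 ltrD2l lerD2l => /ltW.
have arc : is_arc k t2 t1 c1.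
  by move: a1 a2 t1t2; rewrite /is_arc -val_eqE /=; lia.
have := gs_arc gs xa t2P t1P arc; rewrite c20 in lt' *.
have -> : g t2 + c1%:R < g t1 by lra.
by lra.
Qed.

(** Termination measure: the events [g j - c] still ahead of the falling time [t], over all weights
    [c <= n]. *)
Definition pending P g t : nat :=
  #|[pred p : 'I_n * 'I_n.+1 | (p.1 \in P) && (g p.1 < t + (p.2 : nat)%:R)]|.

(** The parking condition on the complement of [P] yields a vertex with at least [a i] arcs into
    [P]; as it is not ready, one of them is unseen. Time drops to the latest pending event. *)
Lemma gs_step P g t : greedy_state P g t -> P != [set: 'I_n] ->
  (forall i, i \notin P -> (seen_from P g t i < a i)%N) ->
  exists2 t', (pending P g t' < pending P g t)%N & greedy_state P g t'.
Proof.
move=> gs PT nr.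
have /parking_functionsP /(_ (~: P)) := a_parking.
have -> : ~: P != finset.set0 by apply: contraNneq PT => P0; rewrite -[P]finset.setCK P0 finset.setC0.
move=> /(_ isT) [i]; rewrite finset.in_setC => iP ai.
have [h [hA hi tP nsh]] : exists h, [/\ h \in arr, hyp_label h = i,
    hyp_tgt h \in P & g (hyp_tgt h) < t + (hyp_cst h)%:R].
  have : ~~ ([pred h in arr | (hyp_label h == i) && (hyp_tgt h \notin ~: P)]
      \subset [pred h in arr | (hyp_label h == i) && seen P g t h]).
    apply: contraTN (nr _ iP) => /subset_leq_card le; rewrite -leqNgt.
    exact: leq_trans ai le.
  case/subsetPn => h; rewrite !inE negbK => /and3P[hA /eqP hi tP].
  rewrite hA hi eqxx /= /seen tP /= -ltNge => lt; by exists h.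
pose pend : pred ('I_n * 'I_n.+1) :=
  fun p => (p.1 \in P) && (g p.1 < t + (p.2 : nat)%:R).
have p0P : pend (hyp_tgt h, inord (hyp_cst h)).
  by rewrite /pend /= tP inordK // ltnS hyp_cst_le.
have [[j c] /andP[/= jP jc] pmax] := @arg_maxP _ _ _ _ pend (fun p : 'I_n * 'I_n.+1 => g p.1 - (p.2 : nat)%:R) p0P.
have {}pmax h' : hyp_tgt h' \in P -> g (hyp_tgt h') < t + (hyp_cst h')%:R ->
    g (hyp_tgt h') - (hyp_cst h')%:R <= g j - (c : nat)%:R.
  move=> h'P h'c; have := pmax (hyp_tgt h', inord (hyp_cst h')).
  by rewrite /pend /= h'P inordK ?ltnS ?hyp_cst_le // h'c => /(_ isT).
pose t' := g j - (c : nat)%:R.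
have t't : t' < t by rewrite /t' ltrBlDr.
(* Only one pair [(j, c)] occurs at time [t'], so each vertex sees at most one new arc. *)
have news h' : seen P g t' h' -> seen P g t h' = false ->
    hyp_tgt h' = j /\ hyp_cst h' = c.
  rewrite /seen => /andP[h'P le]; rewrite h'P /= => /negbT; rewrite -ltNge => lt.
  have e : g (hyp_tgt h') - (hyp_cst h')%:R = g j - (c : nat)%:R.
    by apply/le_anti; rewrite pmax //=; move: le; rewrite /t'; lra.
  have cn : (c <= n)%N by rewrite -ltnS.
  have [h'j|h'j] := eqVneq (hyp_tgt h') j.
    split=> //; move: e; rewrite h'j => /addrI /oppr_inj /eqP.
    by rewrite eqr_nat => /eqP.
  (* Two simultaneous events would make values of [g] differ by a difference of weights, which is
     why [gs_generic] ranges over all [c <= n]. *)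
  exfalso; have [cc|cc] := leqP (hyp_cst h') c.
    have /eqP := gs_generic gs h'P jP h'j (leq_trans (leq_subr (hyp_cst h') c) cn).
    by rewrite natrB //; lra.
  rewrite eq_sym in h'j; have /eqP := gs_generic gs jP h'P h'j
    (leq_trans (leq_subr c (hyp_cst h')) (hyp_cst_le h')).
  by rewrite natrB 1?ltnW //; lra.
exists t'.
  apply: proper_card; apply/properP; split.
    apply/fintype.subsetP => p; rewrite !inE => /andP[-> /=]; lra.
  by exists (j, c); rewrite !inE /= ?jP ?jc // /t' addrNK ltxx.
have mono h' : seen P g t h' -> seen P g t' h'.
  by rewrite /seen => /andP[-> /=]; lra.
split.
- by move=> l /(gs_above gs); apply: le_trans; exact: ltW.
- exact: (gs_generic gs).
- exact: (gs_placed gs).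
- move=> l lP; apply: leq_trans (nr _ lP).
  have [[h0 /andP[/andP[h0A h0l] /andP[h0s h0n]]]|no] := pselect (exists h0,
      ((h0 \in arr) && (hyp_label h0 == l)) &&
      (seen P g t' h0 && ~~ seen P g t h0)); last first.
    apply: leqW; apply: subset_leq_card; apply/fintype.subsetP => h'.
    rewrite !inE => /and3P[h'A h'l h's]; rewrite h'A h'l /=.
    by apply: contra_notT no => h'n; exists h'; rewrite h'A h'l h's.
  apply: (@leq_trans #|[predU1 h0 &
    [pred h in arr | (hyp_label h == l) && seen P g t h]]|); last first.
    by rewrite cardU1 -add1n leq_add2r; case: (_ \notin _).
  apply: subset_leq_card; apply/fintype.subsetP => h'.
  rewrite !inE => /and3P[h'A h'l h's]; rewrite h'A h'l /=.
  case: (boolP (seen P g t h')) => [|h'n]; first by rewrite orbT.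
  have [ej ec] := news _ h's (negbTE h'n).
  have [ej0 ec0] := news _ h0s (negbTE h0n).
  rewrite (arr_inj h'A h0A) ?eqxx ?ej ?ec ?ej0 ?ec0 //.
  by rewrite (eqP h'l) (eqP h0l).
- exact: (gs_agree gs).
- move=> x xa h' h'A h'P h's.
  case: (boolP (seen P g t h')) => [/(gs_agree_seen gs xa h'A h'P) //|h'n].
  have [ej ec] := news _ h's (negbTE h'n).
  (* The top unplaced vertex [m] of [x] crosses some pending arc [h2]. Either [h2] occurs at [t']
     too, or [gs_fifo] compares it with the event at [t']; both give [x m + c < x j], and [x] is no
     larger at the label of [h']. *)
  have [m mP mmax] := arg_maxP x (h'P : (fun j => j \notin P) (hyp_label h')).
  have [h2 [h2A h2m ch2 t2P /andP[lt2 c20]]] := gs_top gs mP (nr _ mP) xa mmax.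
  have := pmax _ t2P lt2; rewrite le_eqVlt => /orP[/eqP e|lt].
    have h2s : seen P g t' h2 by rewrite /seen t2P /t' /= -e; lra.
    have [ej2 ec2] : hyp_tgt h2 = j /\ hyp_cst h2 = c.
      by apply: news => //; rewrite /seen t2P /= leNgt lt2.
    have := mmax _ h'P; move: ch2; rewrite /crossed ej2 ec2 ej ec h2m /=; lra.
  have := mmax _ h'P; rewrite /= => mx.
  have c0 : (0 < hyp_cst h')%N.
    rewrite lt0n ec; apply/eqP => c0; move: jc.
    by rewrite c0 addr0 ltNge (gs_above gs).
  have := gs_fifo gs xa h'A h2A c0 c20; rewrite ej jP ec => /(_ isT t2P).
  have -> : g (hyp_tgt h2) + (c : nat)%:R < g j + (hyp_cst h2)%:R by lra.
  move=> /(_ isT); move: ch2; rewrite /crossed h2m ej ec; lra.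
Qed.

Lemma gs_descend P g t : greedy_state P g t -> P != [set: 'I_n] ->
  exists t', greedy_state P g t' /\
    exists2 i, i \notin P & seen_from P g t' i = a i.
Proof.
have [m] := ubnP (pending P g t); elim: m t => // m IH t; rewrite ltnS.
move=> pm gs PT.
have [[i /andP[iP /eqP ri]]|no] := pselect (exists i, (i \notin P) &&
  (seen_from P g t i == a i)); first by exists t; split=> //; exists i.
have [i iP|t' pt' gs'] := gs_step gs PT; last exact: IH (leq_trans pt' pm) gs' PT.
rewrite ltn_neqAle (gs_unplaced gs iP) andbT.
by apply: contra_notN no => ri; exists i; rewrite iP.
Qed.

Lemma greedy_complete : exists g t, greedy_state [set: 'I_n] g t.
Proof.
have init : greedy_state finset.set0 (fun=> 0 : R) 0.
  have s0 i : seen_from finset.set0 (fun=> 0 : R) 0 i = 0%N.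
    by apply: eq_card0 => h; rewrite !inE /seen finset.in_set0 !andbF.
  split=> [i|i|i|i _|x _ h _|x _ h _ _]; rewrite ?finset.in_set0 //.
    by rewrite s0.
  by rewrite /seen finset.in_set0.
suff main m : forall P g t, greedy_state P g t -> (#|~: P| <= m)%N ->
    exists g t, greedy_state [set: 'I_n] g t by exact: main init (leqnn _).
elim: m => [|m IH] P g t gs.
  rewrite leqn0 cards_eq0 => /eqP P0; exists g, t.
  by rewrite -finset.setC0 -P0 finset.setCK.
have [PT _|PT Pm] := eqVneq P [set: 'I_n]; first by exists g, t; rewrite -PT.
have [t' [gs' [i0 i0P /eqP ri0]]] := gs_descend gs PT.
pose ready : pred 'I_n := fun i => (i \notin P) && (seen_from P g t' i == a i).
have ready0 : ready i0 by rewrite /ready i0P ri0.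
have [i /andP[iP /eqP ri] imin] := arg_minnP (fun i : 'I_n => i : nat) ready0.
have [j jP ji|g' [t'' gs'']] := gs_place gs' iP ri.
  rewrite ltn_neqAle (gs_unplaced gs' jP) andbT.
  by apply/negP => rj; have := imin j; rewrite /ready jP rj leqNgt ji => /(_ isT).
apply: IH gs'' _; rewrite -ltnS; apply: leq_trans Pm.
apply: proper_card; rewrite finset.setCU finset.setIC finset.properEneq finset.subsetIl andbT.
apply: contraNneq iP => /finset.setP /(_ i); rewrite !inE eqxx andbF => /esym/negbT.
by rewrite negbK.
Qed.

(** The first half gives surjectivity of the labeling, the second injectivity. *)
Lemma greedy_point : exists g : 'I_n -> R, labelled_by_a g /\
  forall x, labelled_by_a x -> forall h, h \in arr -> crossed x h = crossed g h.
Proof.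
have [g [t gs]] := greedy_complete; exists g; split; last first.
  by move=> x xa h hA; rewrite (gs_agree gs xa hA) finset.in_setT.
split=> [h hA|i]; last first.
  rewrite -(gs_placed gs (finset.in_setT i)); apply: eq_card => h.
  by rewrite !inE.
by apply: (gs_generic gs); rewrite ?finset.in_setT ?arr_label_tgt ?hyp_cst_le.
Qed.

End Greedy.

(** * Generic segments towards the base region *)

Section Crossing.
Variables (R : realType) (n k : nat) (arr : {set hyp n}).
Hypothesis arr_arc : forall h, h \in arr ->
  is_arc k (hyp_label h) (hyp_tgt h) (hyp_cst h).
Hypothesis arr_inj : forall h h', h \in arr -> h' \in arr ->
  hyp_label h = hyp_label h' -> hyp_tgt h = hyp_tgt h' ->
  hyp_cst h = hyp_cst h' -> h = h'.
Implicit Types (f x y b : 'I_n -> R) (h : hyp n) (s : R).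

Definition excess h f : R := f (hyp_tgt h) - f (hyp_label h) - (hyp_cst h)%:R.

Lemma crossed_excess f h : crossed f h = (0 < excess h f).
Proof. by rewrite /crossed /excess -addrA -opprD subr_gt0. Qed.

Lemma off_excess f : off_arrangement arr f <->
  forall h, h \in arr -> excess h f != 0.
Proof.
have E h : (excess h f != 0) =
    (f (hyp_label h) + (hyp_cst h)%:R != f (hyp_tgt h)).
  by rewrite /excess -addrA -opprD subr_eq0 eq_sym.
by split=> H h /H; rewrite E.
Qed.

Definition segment f g s : 'I_n -> R := fun i => f i + s * (g i - f i).

Lemma excess_segment h f g s :
  excess h (segment f g s) = excess h f + s * (excess h g - excess h f).
Proof. by rewrite /excess /segment; ring. Qed.

(** Supplies the direction of perturbation that breaks a tie between [h] and [h']. *)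
Lemma exists_on_hyp_off_hyp h h' : h \in arr -> h' \in arr -> h != h' ->
  exists w : 'I_n -> R, excess h w = 0 /\ excess h' w != 0.
Proof.
move=> hA h'A hh'.
(* The values 3n+3 and 6n+6 exceed any sum of two weights and are far apart. *)
pose w i := if i == hyp_tgt h then hyp_cst h else if i == hyp_label h then 0%N
  else if i == hyp_tgt h' then (3 * n + 3)%N else (6 * n + 6)%N.
exists (fun i => (w i)%:R); split.
  have := arr_arc hA; rewrite /excess /w eqxx => arc.
  have -> : hyp_label h == hyp_tgt h = false.
    by apply/negbTE; rewrite -val_eqE /=; move: arc; rewrite /is_arc; lia.
  by rewrite eqxx subr0 subrr.
rewrite /excess -addrA -opprD subr_eq0 -natrD eqr_nat /w.
have := hyp_cst_le h; have := hyp_cst_le h'.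
have := arr_arc hA; have := arr_arc h'A.
have : ~~ [&& hyp_label h == hyp_label h' :> nat,
    hyp_tgt h == hyp_tgt h' :> nat & hyp_cst h == hyp_cst h'].
  apply: contra hh' => /and3P[/eqP/val_inj e1 /eqP/val_inj e2 /eqP e3].
  exact/eqP/arr_inj.
rewrite -!val_eqE /= /is_arc; do ?case: ifP => ?; lia.
Qed.

(** A pair [(u, v)] stands for the affine function [u + s * v], whose sign at 0 is to be kept. *)
Lemma small_perturbation (A : seq (R * R)) :
  exists2 e : R, 0 < e & forall p, p \in A -> p.1 != 0 ->
    forall s, 0 < s <= e -> 0 < p.1 * (p.1 + s * p.2).
Proof.
elim: A => [|[u v] A [e e0 He]]; first by exists 1.
have [u0|u0] := eqVneq u 0.
  exists e => // p; rewrite inE => /orP[/eqP -> /=|/He //].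
  by rewrite u0 eqxx.
(* The summand 1 avoids division by zero and makes the bound on [s * v] strict. *)
pose d := `|u| / (1 + `|v|).
have v1 : 0 < 1 + `|v| by rewrite ltr_pwDl.
have d0 : 0 < d by rewrite divr_gt0 ?normr_gt0.
exists (Num.min e d); first by rewrite lt_min e0.
move=> p; rewrite inE => /orP[/eqP -> _ s|pA p0 s] /=; rewrite le_min => /and3P[s0 se sd].
  have : s * (1 + `|v|) <= `|u| by rewrite -ler_pdivlMr.
  move=> su.
  have svu : `|s * v| < `|u| by rewrite normrM gtr0_norm //; lra.
  rewrite -[u * _]/(u * (u + s * v)); move: svu; rewrite ltr_norml.
  have [uu|uu|uu] := ltgtP u 0; last by rewrite uu eqxx in u0.
    by rewrite ltr0_norm // => /andP[_ ?]; rewrite nmulr_rgt0 //; lra.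
  by rewrite gtr0_norm // => /andP[? _]; apply: mulr_gt0 => //; lra.
by apply: He => //; rewrite s0.
Qed.

(* Vanishes exactly when the segment from f to b meets both hyperplanes at the
   same parameter. *)
Definition tie b (p : hyp n * hyp n) f : R :=
  excess p.1 f * excess p.2 b - excess p.2 f * excess p.1 b.

Lemma tie_segment b p f g s :
  tie b p (segment f g s) = tie b p f + s * (tie b p g - tie b p f).
Proof. by rewrite /tie !excess_segment; ring. Qed.

(** Ties are broken one pair at a time, each by a move small enough to keep the sign of every excess
    and of the ties already broken. *)
Lemma generic_in_region b x : (forall h, h \in arr -> excess h b < 0) ->
  off_arrangement arr x -> exists x', [/\ off_arrangement arr x',
    forall h, h \in arr -> crossed x' h = crossed x h &
    forall h h', h \in arr -> h' \in arr -> h != h' -> tie b (h, h') x' != 0].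
Proof.
move=> b0 xo.
suff [x' [x'o x'x x't]] : exists x', [/\ off_arrangement arr x',
    forall h, h \in arr -> crossed x' h = crossed x h &
    forall p, p \in enum {: hyp n * hyp n} -> p.1 \in arr -> p.2 \in arr ->
      p.1 != p.2 -> tie b p x' != 0].
  by exists x'; split=> // h h' hA h'A hh'; apply: x't; rewrite ?mem_enum.
elim: (enum _) => [|[h h'] L [x' [x'o x'x x't]]]; first by exists x; split.
have [t0|t0] := eqVneq (tie b (h, h') x') 0; last first.
  exists x'; split=> // p; rewrite inE => /orP[/eqP ->//|]; exact: x't.
have [/and3P[/= hA h'A hh']|no] := boolP [&& h \in arr, h' \in arr & h != h'];
  last first.
  exists x'; split=> // p; rewrite inE => /orP[/eqP -> /= hA h'A hh'|].
    by rewrite hA h'A hh' in no.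
  exact: x't.
have [w [hw h'w]] := exists_on_hyp_off_hyp hA h'A hh'.
have tw : tie b (h, h') w != 0.
  by rewrite /tie /= hw mul0r sub0r oppr_eq0 mulf_neq0 // ltr0_neq0 // b0.
have [e e0 He] := small_perturbation
  ([seq (excess g x', excess g w - excess g x') | g <- enum arr] ++
   [seq (tie b p x', tie b p w - tie b p x') | p <- L]).
have ee : 0 < e <= e by rewrite e0 lexx.
have He1 g : g \in arr -> 0 < excess g x' * excess g (segment x' w e).
  move=> gA; rewrite excess_segment.
  apply: (He (excess g x', excess g w - excess g x') _ _ e ee).
    by rewrite mem_cat map_f // mem_enum.
  by have /off_excess := x'o; apply.
exists (segment x' w e); split.
- apply/off_excess => g gA; apply/eqP => g0.
  by have := He1 _ gA; rewrite g0 mulr0 ltxx.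
- move=> g gA; rewrite -x'x // !crossed_excess; have := He1 _ gA.
  have [g0|g0|g0] := ltgtP (excess g x') 0.
  + by rewrite nmulr_rgt0 // => /ltW; rewrite leNgt => /negbTE.
  + by rewrite pmulr_rgt0.
  + by rewrite g0 mul0r ltxx.
- move=> p; rewrite inE => /orP[/eqP -> _ _ _|pL p1 p2 p12].
    by rewrite tie_segment t0 add0r subr0 mulf_neq0 // lt0r_neq0.
  have := He (tie b p x', tie b p w - tie b p x') _ (x't _ pL p1 p2 p12) e ee.
  rewrite mem_cat map_f // orbT -tie_segment => /(_ isT).
  by apply: contraTneq => ->; rewrite mulr0 ltxx.
Qed.

(** From a generic point of the region of [x], walk towards [b] and stop just after the first
    crossing. *)
Lemma neighbor_towards b x h0 : (forall h, h \in arr -> excess h b < 0) ->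
  off_arrangement arr x -> h0 \in arr -> crossed x h0 ->
  exists y h, [/\ off_arrangement arr y, h \in arr, crossed x h,
    ~~ crossed y h &
    forall h', h' \in arr -> h' != h -> crossed y h' = crossed x h'].
Proof.
move=> b0 xo h0A ch0.
have [x' [x'o x'x x't]] := generic_in_region b0 xo.
(* The parameter at which the segment from [x'] to [b] meets [h]. *)
pose T h := excess h x' / (excess h x' - excess h b).
pose Q : pred (hyp n) := fun h => (h \in arr) && (0 < excess h x').
have Q0 : Q h0 by rewrite /Q h0A -crossed_excess x'x.
have [h /andP[hA h_gt0] hmin] := @arg_minP _ _ _ _ Q T Q0.
have Tlt h' : Q h' -> h' != h -> T h < T h'.
  move=> Qh' hh'; rewrite lt_neqAle hmin // andbT.
  move: Qh' => /andP[h'A h'0]; apply/eqP.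
  have := b0 _ hA; have := b0 _ h'A => b1 b2.
  have d1 : excess h x' - excess h b != 0 by rewrite lt0r_neq0 //; lra.
  have d2 : excess h' x' - excess h' b != 0 by rewrite lt0r_neq0 //; lra.
  move=> /eqP; rewrite eqr_div // => /eqP e.
  rewrite eq_sym in hh'; have /eqP[] := x't h h' hA h'A hh'.
  by rewrite /tie /=; lra.
have T1 : T h < 1.
  have := b0 _ hA => b1.
  by rewrite ltr_pdivrMr ?mul1r //; lra.
have T0 : 0 < T h.
  have := b0 _ hA => b1.
  by rewrite divr_gt0 //; lra.
(* Signs are reversed to obtain [s] just above [T h]; the entry [- 1] keeps [s] below 1. *)
have [t' t't Ht'] :=
  exists_lt_above (- 1 :: [seq - T h' | h' <- enum arr]) (- T h).
pose s := - t'.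
have s0 : T h < s by rewrite /s; lra.
have s1 : s < 1.
  have := Ht' (- 1); rewrite mem_head => /(_ isT); rewrite /s; lra.
have sT h' : Q h' -> h' != h -> s < T h'.
  move=> Qh' hh'; have := Ht' (- T h').
  rewrite inE (map_f (fun h => - T h)) ?orbT; last first.
    by rewrite mem_enum; case/andP: Qh'.
  by move=> /(_ isT); have := Tlt _ Qh' hh'; rewrite /s; lra.
have yh : excess h (segment x' b s) < 0.
  have := b0 _ hA => b1; rewrite excess_segment.
  move: s0; rewrite ltr_pdivrMr; last lra.
  lra.
have yh' h' : Q h' -> h' != h -> 0 < excess h' (segment x' b s).
  move=> Qh' hh'; have := sT _ Qh' hh'; rewrite excess_segment.
  move: Qh' => /andP[h'A h'0]; have := b0 _ h'A => b1.
  rewrite ltr_pdivlMr; last lra.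
  lra.
have yn h' : h' \in arr -> ~~ crossed x' h' -> excess h' (segment x' b s) < 0.
  rewrite crossed_excess -leNgt excess_segment => h'A le.
  by have := b0 _ h'A => b1; nra.
have dich h' : h' \in arr -> h' != h ->
    if crossed x h' then 0 < excess h' (segment x' b s)
    else excess h' (segment x' b s) < 0.
  move=> h'A hh'; rewrite -x'x //; case: ifP => [c|/negbT]; last exact: yn.
  by apply: yh' => //; rewrite /Q h'A -crossed_excess.
exists (segment x' b s), h; split=> //.
- apply/off_excess => h' h'A; have [->|hh'] := eqVneq h' h.
    by rewrite ltr0_neq0.
  have := dich _ h'A hh'; case: ifP => _; [exact: lt0r_neq0|exact: ltr0_neq0].
- by rewrite -x'x // crossed_excess.
- by rewrite crossed_excess -leNgt ltW.
- move=> h' h'A hh'; rewrite crossed_excess; have := dich _ h'A hh'.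
  by case: ifP => _ H; [rewrite H|rewrite ltNge ltW].
Qed.

End Crossing.

Local Open Scope classical_set_scope.

(** * Effect of crossing a single hyperplane *)

Section Neighbors.
Variables (R : realType) (n : nat) (arr : {set hyp n}).
Implicit Types (f g : 'I_n -> R) (h : hyp n).

Lemma pslabel_uncrossed f m :
  (forall h, h \in arr -> crossed f h = false) -> pslabel arr f m = 0%N.
Proof.
move=> f0; apply: eq_card0 => h; rewrite !inE.
by case: (boolP (h \in arr)) => //= /f0 ->; rewrite andbF.
Qed.

Definition crossing_number f : nat := #|[pred h in arr | crossed f h]|.

Variables (f g : 'I_n -> R) (h : hyp n).
Hypotheses (hA : h \in arr) (fh : crossed f h = false) (gh : crossed g h).
Hypothesis fg : forall h', h' \in arr -> h' != h -> crossed f h' = crossed g h'.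

Lemma pslabel_neighbor m :
  pslabel arr g m = (pslabel arr f m + (m == hyp_label h))%N.
Proof.
rewrite /pslabel (cardD1 h) [in RHS](cardD1 h) addnAC.
rewrite !inE hA fh gh andbF andbT eq_sym add0n; congr (_ + _)%N.
apply: eq_card => h'; rewrite !inE; have [//|hh'] := eqVneq h' h.
by case: (boolP (h' \in arr)) => //= h'A; rewrite fg.
Qed.

Lemma crossing_number_lt : (crossing_number f < crossing_number g)%N.
Proof.
apply: proper_card; apply/properP; split; last first.
  by exists h; rewrite !inE ?hA ?fh.
apply/fintype.subsetP => h'; rewrite !inE => /andP[h'A]; rewrite h'A /=.
by have [->|hh'] := eqVneq h' h; rewrite ?fh ?fg.
Qed.

End Neighbors.

(** * Regions as sets of constant crossing pattern *)

Section Cells.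
Variables (R : realType) (n : nat) (X : {set 'I_n}).
Implicit Types (x y z : 'rV[R]_n) (h : hyp n).
Local Notation arr := (arrangement X).
Local Notation compl := (arr_complement R X).
Local Notation comp := (connected_component (arr_complement R X)).

Lemma hyperplane_excess x h : hyperplane R h x <-> excess h (x 0) = 0.
Proof.
by case: h => i j; rewrite /hyperplane /excess /hyp_tgt /=; split; lra.
Qed.

Lemma arr_complementP x : compl x <-> off_arrangement arr (x 0).
Proof.
rewrite off_excess; split=> [xc h hA|xo].
  by apply/eqP => /hyperplane_excess hx; apply: xc; exists h.
by move=> [h /= hA /hyperplane_excess hx]; have /eqP := xo h hA.
Qed.

Definition crossed_side h : set 'rV[R]_n := [set x | 0 < excess h (x 0)].
Definition uncrossed_side h : set 'rV[R]_n := [set x | excess h (x 0) < 0].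

(** The crossed side is below for C and above for S and I; [separates] and [same_side] are symmetric
    under this exchange. *)
Lemma hyp_sides h :
  (hyp_above R h = crossed_side h /\ hyp_below R h = uncrossed_side h) \/
  (hyp_above R h = uncrossed_side h /\ hyp_below R h = crossed_side h).
Proof.
case: h => i j; [right|left|left];
  split; apply/seteqP; split=> x;
  rewrite /hyp_above /hyp_below /crossed_side /uncrossed_side /excess /hyp_tgt /=;
  lra.
Qed.

Lemma excess_continuous h : continuous (fun x => excess h (x 0)).
Proof.
move=> x; have co j := @coord_continuous R 1 n 0 j x.
exact: cvgB (cvgB (co _) (co _)) (cvg_cst _).
Qed.

Lemma segment_continuous x y :
  continuous (fun s : R => x + s *: (y - x) : 'rV[R]_n).
Proof.
move=> s U /nbhs_ballP[e /= e0 eU].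
(* A positive Lipschitz constant of the segment in the sup norm. *)
pose M := 1 + \sum_j `|y 0 j - x 0 j|.
have M0 : 0 < M by rewrite ltr_pwDl // sumr_ge0.
apply/nbhs_ballP; exists (e / M); first by rewrite /= divr_gt0.
move=> u /= su; apply: eU; split=> // i j; rewrite ord1 !mxE.
have djM : `|y 0 j - x 0 j| <= M.
  rewrite /M (bigD1 j) //= addrCA lerDl addr_ge0 // sumr_ge0 //.
rewrite /ball /=.
have -> : x 0 j + s * (y 0 j - x 0 j) - (x 0 j + u * (y 0 j - x 0 j))
   = (s - u) * (y 0 j - x 0 j) by ring.
rewrite normrM; move: su; rewrite /ball /= ltr_pdivlMr //.
by apply: le_lt_trans; rewrite ler_wpM2l.
Qed.

Lemma excess_vsegment h x y (s : R) : excess h ((x + s *: (y - x)) 0) =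
  excess h (x 0) + s * (excess h (y 0) - excess h (x 0)).
Proof. by rewrite /excess !mxE; ring. Qed.

(** The image of a component under the continuous [excess h] is an interval avoiding 0. *)
Lemma component_crossed x y h : h \in arr -> comp x y ->
  crossed (x 0) h = crossed (y 0) h.
Proof.
move=> hA xy.
have iC : is_interval ((fun z => excess h (z 0)) @` comp x).
  apply/connected_intervalP/connected_continuous_connected.
    exact: component_connected.
  exact/continuous_subspaceT/excess_continuous.
have xx : comp x x.
  by case: xy => C [Cx Cc Cco] Cy; exists C => //; split.
have no0 : ~ ((fun z => excess h (z 0)) @` comp x) 0.
  move=> [z /connected_component_sub/arr_complementP/off_excess zo z0].
  by have := zo h hA; rewrite z0 eqxx.
have Ix : ((fun z => excess h (z 0)) @` comp x) (excess h (x 0)) by exists x.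
have Iy : ((fun z => excess h (z 0)) @` comp x) (excess h (y 0)) by exists y.
rewrite !crossed_excess; apply/idP/idP => lt.
- apply: contra_notT no0; rewrite -leNgt => le.
  by apply: iC Iy Ix _ _; rewrite le ltW.
- apply: contra_notT no0; rewrite -leNgt => le.
  by apply: iC Ix Iy _ _; rewrite le ltW.
Qed.

(** By convexity: along the segment each excess keeps the sign shared by its two ends. *)
Lemma crossed_component x y : compl x -> compl y ->
  (forall h, h \in arr -> crossed (x 0) h = crossed (y 0) h) -> comp x y.
Proof.
move=> /arr_complementP/off_excess xo /arr_complementP/off_excess yo xy.
pose seg (s : R) := x + s *: (y - x) : 'rV[R]_n.
suff : seg @` `[0, 1] `<=` comp x.
  by apply; exists 1; rewrite /seg /= ?scale1r ?subrKC // in_itv /= ler01 lexx.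
apply: connected_component_max.
- by exists 0; rewrite /seg /= ?scale0r ?addr0 // in_itv /= ler01 lexx.
- move=> _ [s /= + <-]; rewrite in_itv /= => /andP[s0 s1].
  apply/arr_complementP/off_excess => h hA; rewrite excess_vsegment.
  have := xy h hA; have := xo h hA; have := yo h hA; rewrite !crossed_excess.
  by case: (ltgtP (excess h (x 0)) 0); case: (ltgtP (excess h (y 0)) 0) => //;
    move=> ? ? _ _ _; apply/eqP; nra.
- apply: connected_continuous_connected; first exact: segment_connected.
  exact/continuous_subspaceT/segment_continuous.
Qed.

Lemma componentE x : compl x -> comp x = [set y | compl y /\
  forall h, h \in arr -> crossed (x 0) h = crossed (y 0) h].
Proof.
move=> xc; apply/seteqP; split=> y.
  by move=> xy; split=> [|h hA]; [exact: connected_component_sub xy|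
    exact: component_crossed].
by move=> [yc xy]; exact: crossed_component.
Qed.

Lemma component_sub_crossed x h : h \in arr -> compl x ->
  (comp x `<=` crossed_side h <-> crossed (x 0) h) /\
  (comp x `<=` uncrossed_side h <-> ~~ crossed (x 0) h).
Proof.
move=> hA xc; split; split.
- by move=> /(_ x (connected_component_refl xc)); rewrite crossed_excess.
- move=> cx y /(component_crossed hA); rewrite cx /crossed_side /=.
  by rewrite crossed_excess => <-.
- move=> /(_ x (connected_component_refl xc)); rewrite crossed_excess -leNgt.
  exact: ltW.
- move=> cx y xy; rewrite /uncrossed_side /= lt_neqAle.
  have := connected_component_sub xy => /arr_complementP/off_excess -> //=.
  by rewrite leNgt -crossed_excess -(component_crossed hA xy).
Qed.

Lemma separatesP x y h : h \in arr -> compl x -> compl y ->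
  separates h (comp x) (comp y) <-> crossed (x 0) h != crossed (y 0) h.
Proof.
move=> hA xc yc; have [xC xU] := component_sub_crossed hA xc.
have [yC yU] := component_sub_crossed hA yc.
rewrite /separates; case: (hyp_sides h) => -[-> ->];
  rewrite xC xU yC yU; case: (crossed _ _); case: (crossed _ _) => /=;
  by split=> [[[]|[]]|] //; first [by left | by right].
Qed.

Lemma same_sideP x y h : h \in arr -> compl x -> compl y ->
  same_side h (comp x) (comp y) <-> crossed (x 0) h = crossed (y 0) h.
Proof.
move=> hA xc yc; have [xC xU] := component_sub_crossed hA xc.
have [yC yU] := component_sub_crossed hA yc.
rewrite /same_side; case: (hyp_sides h) => -[-> ->];
  rewrite xC xU yC yU; case: (crossed _ _); case: (crossed _ _) => /=;
  by split=> [[[]|[]]|] //; first [by left | by right].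
Qed.

End Cells.

(** * The Pak-Stanley labeling of regions and its bijectivity *)

Section Labeling.
Variables (R : realType) (n k : nat).
Hypotheses (n_gt1 : (1 < n)%N) (k_gt0 : (0 < k)%N).
Implicit Types (x y z b : 'rV[R]_n) (h : hyp n).
Local Notation X := (open_interval n k).
Local Notation arr := (arrangement X).
Local Notation compl := (arr_complement R X).
Local Notation comp := (connected_component (arr_complement R X)).

(** With decreasing coordinates, the single bound [x_1 < x_n + 1] controls every S- and
    I-hyperplane. *)
Lemma base_regionE : base_region R n =
  [set y | compl y /\ forall h, h \in arr -> ~~ crossed (y 0) h].
Proof.
have n_gt0 : (0 < n)%N by exact: ltnW.
have n1n : (n.-1 < n)%N by rewrite prednK.
pose i0 : 'I_n := Ordinal n_gt0; pose i1 : 'I_n := Ordinal n1n.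
apply/seteqP; split=> y.
  move=> [ydec yspan].
  have le j : y 0 j <= y 0 i0.
    have [->//|ne] := eqVneq j i0; apply/ltW/ydec; move: ne; rewrite -val_eqE /=; lia.
  have ge j : y 0 i1 <= y 0 j.
    have [->//|ne] := eqVneq j i1; apply/ltW/ydec.
    by move: ne (ltn_ord j); rewrite -val_eqE /=; lia.
  have sp : y 0 i0 < y 0 i1 + 1 by apply: yspan => //=; rewrite prednK.
  have neg h : h \in arr -> excess h (y 0) < 0.
    rewrite /excess; case: h => i j; rewrite inE /hyp_tgt /= => hA.
    - by have := ydec _ _ hA; lra.
    - by have := le i; have := ge j; lra.
    - have -> : ord_first i = i0 by apply: val_inj.
      have := ge j; rewrite -natr1; have := ler0n R i; lra.
  split; last by move=> h /neg; rewrite crossed_excess -leNgt => /ltW.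
  by apply/arr_complementP/off_excess => h /neg; apply: ltr0_neq0.
move=> [/arr_complementP/off_excess yo yc].
have neg h : h \in arr -> excess h (y 0) < 0.
  move=> hA; rewrite lt_neqAle yo //= leNgt -crossed_excess; exact: yc.
split=> [i j ij|i j i0' j1].
  have := neg (HC i j); rewrite inE /excess /hyp_tgt /= => /(_ ij); lra.
(* The bound is the uncrossed side of [I_{1n}], which is in the arrangement because [k_gt0] keeps 1
   out of [X]. *)
have := neg (HI i j); rewrite inE /excess /hyp_tgt /=.
have -> : ord_first i = i by apply: val_inj.
have -> : (i \notin X) && (i < j)%N by rewrite inE; lia.
by move=> /(_ isT); rewrite i0'; lra.
Qed.

Definition base_point : 'rV[R]_n := \row_j (- (j : nat)%:R / n%:R).

Lemma base_point_in : base_region R n base_point.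
Proof.
have n0 : 0 < n%:R :> R by rewrite ltr0n ltnW.
split=> [i j ij|i j i0 j1]; rewrite !mxE.
  by rewrite ltr_pM2r ?invr_gt0 // ltrN2 ltr_nat.
rewrite i0 oppr0 mul0r addrC mulNr subr_gt0 ltr_pdivrMr // mul1r ltr_nat.
exact: ltn_ord.
Qed.

Lemma base_point_off : compl base_point.
Proof. by have := base_point_in; rewrite base_regionE => -[]. Qed.

Lemma base_point_uncrossed h : h \in arr -> crossed (base_point 0) h = false.
Proof.
by have := base_point_in; rewrite base_regionE => -[_ H] /H /negbTE.
Qed.

Lemma base_region_component : base_region R n = comp base_point.
Proof.
rewrite base_regionE componentE; last exact: base_point_off.
apply/seteqP; split=> y [yc Hy]; split=> // h hA.
  by rewrite base_point_uncrossed //; apply/esym/negbTE/Hy.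
by rewrite -Hy // base_point_uncrossed.
Qed.

(** The label is read at a point picked by [xget], with default 0 for the empty set;
    [component_crossed] makes it well defined on regions. *)
Definition region_label (U : set 'rV[R]_n) : {ffun 'I_n -> nat} :=
  [ffun m => pslabel arr (xget 0 U 0) m].

Lemma region_label_component x : compl x ->
  region_label (comp x) = [ffun m => pslabel arr (x 0) m].
Proof.
move=> xc; apply/ffunP => m; rewrite !ffunE; apply/esym/eq_pslabel => h hA.
apply: component_crossed hA _; apply: xgetPex.
by exists x; exact: connected_component_refl.
Qed.

Lemma region_label_pak_stanley : pak_stanley_labeling X region_label.
Proof.
split.
  rewrite base_region_component region_label_component; last exact: base_point_off.
  apply/ffunP => m; rewrite !ffunE pslabel_uncrossed // => h.
  exact: base_point_uncrossed.
move=> _ _ h [x xc <-] [y yc <-] [hA hsep huniq].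
rewrite base_region_component => /(same_sideP hA base_point_off xc).
rewrite base_point_uncrossed // => /esym xh.
have /(separatesP hA xc yc) := hsep; rewrite xh => yh.
rewrite !region_label_component //; apply/ffunP => m; rewrite !ffunE.
apply: pslabel_neighbor => // [|h' h'A hh'].
  by move: yh; case: (crossed _ _).
apply/eqP; apply: contraNT hh' => ne; apply/eqP/huniq => //.
exact/separatesP.
Qed.

(** Induction on the number of crossed hyperplanes: [neighbor_towards] gives an adjacent region with
    fewer, and a region with none is the base region. *)
Lemma pak_stanley_labeling_unique l l' :
  pak_stanley_labeling X l -> pak_stanley_labeling X l' ->
  forall U, regions R X U -> l' U = l U.
Proof.
move=> [l0 lS] [l'0 l'S] _ [x xc <-].
have [m] := ubnP (crossing_number arr (x 0)).
elim: m x xc => // m IH x xc; rewrite ltnS => xm.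
have [[h0 /andP[h0A h0x]]|no] := pselect (exists h0,
    (h0 \in arr) && crossed (x 0) h0); last first.
  have -> : comp x = base_region R n; last by rewrite l0 l'0.
  rewrite base_region_component; apply/esym/same_connected_component.
  apply: crossed_component => //; first exact: base_point_off.
  move=> h hA; rewrite base_point_uncrossed //; apply/esym/negbTE.
  by apply: contra_notN no => hx; exists h; rewrite hA.
have bneg h : h \in arr -> excess h (base_point 0) < 0.
  have := base_point_off => /arr_complementP/off_excess bo hA.
  by rewrite lt_neqAle bo //= leNgt -crossed_excess base_point_uncrossed.
have [y [h [yo hA hx hy hxy]]] := neighbor_towards
  (@arrangement_arc n k) (fun h h' => @arrangement_inj n k h h' k_gt0)
  bneg (proj1 (arr_complementP _ _) xc) h0A h0x.
pose y' : 'rV[R]_n := \row_j y j.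
have y'E : y' 0 = y by apply/funext => j; rewrite mxE.
have y'c : compl y' by apply/arr_complementP; rewrite y'E.
have adj : adjacent_across X h (comp y') (comp x).
  split=> //; first by apply/separatesP => //; rewrite y'E hx (negbTE hy).
  move=> h' h'A /separatesP => /(_ h'A y'c xc); rewrite y'E => ne.
  by apply/eqP; apply: contraNT ne => hh'; rewrite hxy.
have side : same_side h (base_region R n) (comp y').
  rewrite base_region_component; apply/same_sideP => //.
    exact: base_point_off.
  by rewrite base_point_uncrossed // y'E (negbTE hy).
have ry : regions R X (comp y') by exists y'.
have rx : regions R X (comp x) by exists x.
rewrite (lS _ _ h ry rx adj side) (l'S _ _ h ry rx adj side) IH //.
apply: leq_trans xm; rewrite y'E.
by apply: crossing_number_lt hA _ hx hxy; exact: negbTE.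
Qed.

Lemma region_label_bij :
  set_bij (regions R X) (parking_functions (digraph X)) region_label.
Proof.
have greedy a (pa : parking_functions (digraph X) a) := @greedy_point R n k
  arr (@arrangement_arc n k) (@arc_arrangement n k)
  (fun h h' => @arrangement_inj n k h h' k_gt0) a pa.
split.
- move=> _ [x xc <-]; rewrite region_label_component //.
  exact: pslabel_parking.
- move=> U V; rewrite !inE => -[x xc <-] [y yc <-].
  rewrite !region_label_component // => e.
  (* Both [x] and [y] carry this label, so both cross exactly the hyperplanes crossed by [g]. *)
  have [g [_ Hg]] := greedy _ (pslabel_parking arr (x 0)).
  apply: same_connected_component; apply: crossed_component => // h hA.
  rewrite !(Hg _ _ _ hA) //; split=> [|m]; first exact/arr_complementP.
  + by rewrite e ffunE.
  + exact/arr_complementP.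
  + by rewrite ffunE.
- move=> a /greedy[g [[go ga] _]].
  pose x : 'rV[R]_n := \row_j g j.
  have xE : x 0 = g by apply/funext => j; rewrite mxE.
  have xc : compl x by apply/arr_complementP; rewrite xE.
  exists (comp x); first by exists x.
  by rewrite region_label_component // xE; apply/ffunP => m; rewrite ffunE ga.
Qed.

End Labeling.

Theorem theorem3p7 (R : realType) (n k : nat)
    (hn : (3 <= n)%N) (hk1 : (1 <= k)%N) (hkn : (k < n)%N) :
  let X : {set 'I_n} := open_interval n k in
  exists l : set 'rV[R]_n -> {ffun 'I_n -> nat},
    [/\ pak_stanley_labeling X l,
        (forall l' : set 'rV[R]_n -> {ffun 'I_n -> nat},
           pak_stanley_labeling X l' ->
           forall U : set 'rV[R]_n, regions R X U -> l' U = l U)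
      & set_bij (regions R X) (parking_functions (digraph X)) l].
Proof.
have n_gt1 : (1 < n)%N by exact: leq_trans hn.
exists (@region_label R n k); split.
- exact: region_label_pak_stanley.
- move=> l' psl'; apply: pak_stanley_labeling_unique => //.
  exact: region_label_pak_stanley.
- exact: region_label_bij.
Qed.
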